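(* Let $f,\rho\in\mathcal{C}^1(SE(2))$ be supported in $\mathbb{D}_{1/4}^\circ$, with $\rho$ radial in translations. Then there is a constant $C>0$ (depending only on $f$ and $\rho$) such that for all $\mathbf{K}\in\mathbb{N}^3$, with $\mathbf{L}:=2\mathbf{K}+1$, and all $\mathbf{k}\in\mathbb{Z}^3$ with $|\mathbf{k}|\le\mathbf{K}$, \[ \left|\widehat{f\star\rho}[\mathbf{k};\mathbf{L}]-\widehat{f}[\mathbf{k};\mathbf{L}]\,\widehat{\rho}[\mathbf{k};\mathbf{L}]\right|\le\frac{C}{\min(\mathbf{K})}. \] In particular, for $K\in\mathbb{N}$ and $\|\mathbf{k}\|_\infty\le K$, $\left|\widehat{f\star\rho}[\mathbf{k};2K+1]-\widehat{f}[\mathbf{k};2K+1]\widehat{\rho}[\mathbf{k};2K+1]\right|\le C/K$.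
   Context: $SE(2)=\mathbb{R}^2\rtimes SO(2)$ with group law $(\mathbf{x},\mathbf{R})\circ(\mathbf{x}',\mathbf{R}')=(\mathbf{x}+\mathbf{R}\mathbf{x}',\mathbf{R}\mathbf{R}')$, elements parametrized by $(x,y,\theta)\in\mathbb{R}^2\times[0,2\pi)$, Haar measure $\frac{1}{2\pi}\mathrm{d}x\,\mathrm{d}y\,\mathrm{d}\theta$; convolution $(f_1\star f_2)(\mathbf{h})=\int_{SE(2)}f_1(\mathbf{g})f_2(\mathbf{g}^{-1}\circ\mathbf{h})\,\mathrm{d}\mathbf{g}$. $\mathcal{C}^1(SE(2))$: continuously differentiable in $(x,y,\theta)$, $2\pi$-periodic in $\theta$. $\mathbb{D}_a^\circ=\{(\mathbf{x},\mathbf{R}):\|\mathbf{x}\|_2<a\}$. $\rho$ radial in translations: $\rho(\mathbf{x},\mathbf{R})=\rho(\mathbf{S}\mathbf{x},\mathbf{R})$ for all $\mathbf{x}\in\mathbb{R}^2$, $\mathbf{R},\mathbf{S}\in SO(2)$. For $\mathbf{k}\in\mathbb{Z}^3$, $\phi_{\mathbf{k}}(x,y,\theta)=e^{2\pi\mathrm{i}(k_1x+k_2y)}e^{\mathrm{i}k_3\theta}$. For $\mathbf{L}=(L_{\mathrm x},L_{\mathrm y},L_{\mathrm r})\in\mathbb{N}^3$, grid points $x_i=-\tfrac12+\tfrac{i-1}{L_{\mathrm x}}$, $y_j=-\tfrac12+\tfrac{j-1}{L_{\mathrm y}}$, $\theta_l=\tfrac{2\pi(l-1)}{L_{\mathrm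 r}}$, and for a function $g$ on $SE(2)$, $\widehat{g}[\mathbf{k};\mathbf{L}]=\frac{1}{L_{\mathrm x}L_{\mathrm y}L_{\mathrm r}}\sum_{i,j,l}g(x_i,y_j,\theta_l)\overline{\phi_{\mathbf{k}}(x_i,y_j,\theta_l)}$ (scalar $L$ means $(L,L,L)$). For $\mathbf{K}\in\mathbb{N}^3$: $2\mathbf{K}+1$ componentwise, $\min(\mathbf{K})$ smallest entry, $|\mathbf{k}|\le\mathbf{K}$ componentwise. *)

(* Defs.v *)
From Stdlib Require Import Reals ZArith List.
From Coquelicot Require Import Coquelicot.
Open Scope R_scope.

(* Functions on SE(2) in coordinates (x, y, theta), complex valued. *)
Definition SE2fun := R -> R -> R -> C.

Definition cis (t : R) : C := (cos t, sin t).

Definition continuous3 (h : R -> R -> R -> R) : Prop :=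
  forall x y t eps, 0 < eps -> exists delta, 0 < delta /\
    forall x' y' t', Rabs (x' - x) < delta -> Rabs (y' - y) < delta ->
      Rabs (t' - t) < delta -> Rabs (h x' y' t' - h x y t) < eps.

Definition C1_real (g : R -> R -> R -> R) : Prop :=
  exists gx gy gt : R -> R -> R -> R,
    (forall x y t, is_derive (fun u => g u y t) x (gx x y t)) /\
    (forall x y t, is_derive (fun u => g x u t) y (gy x y t)) /\
    (forall x y t, is_derive (fun u => g x y u) t (gt x y t)) /\
    continuous3 gx /\ continuous3 gy /\ continuous3 gt.

Definition C1_SE2 (f : SE2fun) : Prop :=
  C1_real (fun x y t => fst (f x y t)) /\ C1_real (fun x y t => snd (f x y t)) /\
  (forall x y t, f x y (t + 2 * PI) = f x y t).

Definition in_support (f : SE2fun) (x y t : R) : Prop :=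
  forall eps, 0 < eps -> exists x' y' t',
    Rabs (x' - x) < eps /\ Rabs (y' - y) < eps /\ Rabs (t' - t) < eps /\
    f x' y' t' <> RtoC 0.

Definition supported_in_disk (f : SE2fun) (a : R) : Prop :=
  forall x y t, in_support f x y t -> sqrt (x ^ 2 + y ^ 2) < a.

Definition radial_in_translations (rho : SE2fun) : Prop :=
  forall x y t a,
    rho (cos a * x - sin a * y) (sin a * x + cos a * y) t = rho x y t.

(* Integral over SE(2) w.r.t. Haar measure (1/2pi) dx dy dtheta,
   x,y over R (improper integrals), theta over [0, 2pi). *)
Definition SE2_integral (F : SE2fun) : C :=
  Cmult (RtoC (/ (2 * PI)))
    (@RInt_gen C_R_CompleteNormedModule (fun x : R =>
       @RInt_gen C_R_CompleteNormedModule (fun y : R =>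
          @RInt C_R_CompleteNormedModule (fun t : R => F x y t) 0 (2 * PI))
         (Rbar_locally m_infty) (Rbar_locally p_infty))
       (Rbar_locally m_infty) (Rbar_locally p_infty)).

(* (f * rho)(h) = int f(g) rho(g^{-1} o h) dg, with
   g^{-1} o h = (R_theta^{-1} (x_h - x_g), theta_h - theta_g) *)
Definition SE2_conv (f rho : SE2fun) : SE2fun :=
  fun x' y' t' => SE2_integral (fun x y t =>
    Cmult (f x y t)
      (rho (cos t * (x' - x) + sin t * (y' - y))
           (- sin t * (x' - x) + cos t * (y' - y)) (t' - t))).

Definition csum (n : nat) (F : nat -> C) : C :=
  fold_right Cplus (RtoC 0) (map F (seq 0 n)).

Definition phi_conj (k1 k2 k3 : Z) (x y t : R) : C :=
  cis (- (2 * PI * (IZR k1 * x + IZR k2 * y) + IZR k3 * t)).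

(* Discrete Fourier coefficient hat g[k; L] with grid
   x_i = -1/2 + (i-1)/Lx, y_j = -1/2 + (j-1)/Ly, theta_l = 2pi(l-1)/Lr
   (here indices are shifted to start at 0). *)
Definition dft (g : SE2fun) (k1 k2 k3 : Z) (Lx Ly Lr : nat) : C :=
  Cmult (RtoC (/ (INR Lx * INR Ly * INR Lr)))
    (csum Lx (fun i => csum Ly (fun j => csum Lr (fun l =>
       let x := - / 2 + INR i / INR Lx in
       let y := - / 2 + INR j / INR Ly in
       let t := 2 * PI * INR l / INR Lr in
       Cmult (g x y t) (phi_conj k1 k2 k3 x y t))))).

(* Main.v *)
(* Since [rho] is radial, the rotation in the group convolution disappears and [f * rho] is an
   ordinary convolution. Functions of class C1 with these supports are Lipschitz, so at every grid
   point the convolution integral differs by O(1/min L) from its Riemann sum over the grid, and the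
   DFT of that discrete convolution factors as the DFT of [f] times averages of
   [rho * phi_conj] over the grid of differences.
   As the [L] are odd, differences of grid points are off the grid by half a step. The Fourier mode
   oscillates at the scale of the grid, so a half step cannot be absorbed by a Lipschitz bound
   alone; instead, a half step multiplies an average by some [w] up to O(1/L) and two half steps
   change nothing, so the two averages [a], [b] satisfy [(1 + w) (b - a) = O(1/L)], where
   [|1 + w| >= 1] because [|k| <= K]. *)

Require Import Defs.
From Stdlib Require Import Reals ZArith List Lra Lia.
From Stdlib Require Import Classical ClassicalEpsilon FunctionalExtensionality.
From Coquelicot Require Import Coquelicot.
Open Scope R_scope.

(** * Finite averages *)

Lemma csum_S (n : nat) (F : nat -> C) :
  csum (S n) F = Cplus (csum n F) (F n).
Proof.
  unfold csum. rewrite seq_S, map_app, fold_right_app. simpl.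
  generalize (map F (seq 0 n)) as l; induction l as [|z l IH]; simpl; [ring|].
  rewrite IH; ring.
Qed.

Lemma csum_ext (n : nat) (F G : nat -> C) :
  (forall i, (i < n)%nat -> F i = G i) -> csum n F = csum n G.
Proof.
  induction n as [|n IH]; intros H; [reflexivity|].
  rewrite !csum_S, IH, H; auto with arith.
Qed.

Lemma csum_minus (n : nat) (F G : nat -> C) :
  csum n (fun i => Cminus (F i) (G i)) = Cminus (csum n F) (csum n G).
Proof.
  induction n as [|n IH]; [unfold csum; simpl; ring|].
  rewrite !csum_S, IH; ring.
Qed.

Lemma csum_plus (n : nat) (F G : nat -> C) :
  csum n (fun i => Cplus (F i) (G i)) = Cplus (csum n F) (csum n G).
Proof.
  induction n as [|n IH]; [unfold csum; simpl; ring|].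
  rewrite !csum_S, IH; ring.
Qed.

Lemma csum_scal (n : nat) (z : C) (F : nat -> C) :
  csum n (fun i => Cmult z (F i)) = Cmult z (csum n F).
Proof.
  induction n as [|n IH]; [unfold csum; simpl; ring|].
  rewrite !csum_S, IH; ring.
Qed.

Lemma csum_swap (m n : nat) (F : nat -> nat -> C) :
  csum m (fun i => csum n (fun j => F i j)) =
  csum n (fun j => csum m (fun i => F i j)).
Proof.
  induction n as [|n IH].
  - induction m as [|m IHm]; [reflexivity|].
    rewrite csum_S, IHm. unfold csum; simpl; ring.
  - rewrite csum_S, <- IH, <- csum_plus.
    apply csum_ext; intros; apply csum_S.
Qed.

Lemma Cmod_csum_le (n : nat) (F : nat -> C) (M : R) :
  (forall i, (i < n)%nat -> Cmod (F i) <= M) -> Cmod (csum n F) <= INR n * M.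
Proof.
  induction n as [|n IH]; intros H.
  - unfold csum; simpl. rewrite Cmod_0; lra.
  - rewrite csum_S, S_INR.
    eapply Rle_trans; [apply Cmod_triangle|].
    specialize (IH ltac:(auto with arith)). specialize (H n ltac:(lia)). lra.
Qed.

(** Normalised sums, so that a uniform error bound on the terms passes unchanged through nested
    averages. *)
Definition avg (n : nat) (F : nat -> C) : C := Cmult (RtoC (/ INR n)) (csum n F).

Lemma avg_ext (n : nat) (F G : nat -> C) :
  (forall i, (i < n)%nat -> F i = G i) -> avg n F = avg n G.
Proof. intros H; unfold avg; now rewrite (csum_ext n F G). Qed.

Lemma avg_minus (n : nat) (F G : nat -> C) :
  Cminus (avg n F) (avg n G) = avg n (fun i => Cminus (F i) (G i)).
Proof. unfold avg; rewrite csum_minus; ring. Qed.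

Lemma avg_scal (n : nat) (z : C) (F : nat -> C) :
  avg n (fun i => Cmult z (F i)) = Cmult z (avg n F).
Proof. unfold avg; rewrite csum_scal; ring. Qed.

Lemma avg_swap (m n : nat) (F : nat -> nat -> C) :
  avg m (fun i => avg n (fun j => F i j)) = avg n (fun j => avg m (fun i => F i j)).
Proof. unfold avg; rewrite !csum_scal, csum_swap; ring. Qed.

Lemma Cmod_avg_le (n : nat) (F : nat -> C) (M : R) :
  (0 < n)%nat -> (forall i, (i < n)%nat -> Cmod (F i) <= M) -> Cmod (avg n F) <= M.
Proof.
  intros Hn H. unfold avg. apply lt_INR in Hn; simpl in Hn.
  rewrite Cmod_mult, Cmod_R, Rabs_pos_eq
    by (left; now apply Rinv_0_lt_compat).
  apply Rmult_le_reg_l with (INR n); [assumption|].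
  rewrite <- Rmult_assoc, Rinv_r, Rmult_1_l by lra.
  now apply Cmod_csum_le.
Qed.

Lemma avg_dist_le (n : nat) (F G : nat -> C) (M : R) :
  (0 < n)%nat -> (forall i, (i < n)%nat -> Cmod (Cminus (F i) (G i)) <= M) ->
  Cmod (Cminus (avg n F) (avg n G)) <= M.
Proof. intros; rewrite avg_minus; now apply Cmod_avg_le. Qed.

Lemma Cmod_minus_trans (b a c : C) (p q : R) :
  Cmod (Cminus a b) <= p -> Cmod (Cminus b c) <= q -> Cmod (Cminus a c) <= p + q.
Proof.
  intros; replace (Cminus a c) with (Cplus (Cminus a b) (Cminus b c)) by ring.
  eapply Rle_trans; [apply Cmod_triangle | lra].
Qed.

(** The shift drops the term [H s] and gains [H (s + INR n * d)]; all other terms are common to both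
    sums. *)
Lemma avg_shift (n : nat) (H : R -> C) (s d : R) :
  H (s + INR n * d) = H s ->
  avg n (fun i => H (s + d + INR i * d)) = avg n (fun i => H (s + INR i * d)).
Proof.
  intros Hs. unfold avg. f_equal.
  (* Both sides are the sum of [H] over the [m + 1] points from [s] to [s + INR m * d]. *)
  assert (E : forall m, Cplus (csum m (fun i => H (s + d + INR i * d))) (H s) =
    Cplus (csum m (fun i => H (s + INR i * d))) (H (s + INR m * d))).
  { induction m as [|m IH].
    - unfold csum; simpl. now rewrite Rmult_0_l, Rplus_0_r.
    - rewrite !csum_S, S_INR.
      replace (s + (INR m + 1) * d) with (s + d + INR m * d) by ring.
      transitivity (Cplus (Cplus (csum m (fun i => H (s + d + INR i * d))) (H s))
        (H (s + d + INR m * d))); [ring | rewrite IH; ring]. }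
  specialize (E n). rewrite Hs in E.
  replace (csum n (fun i => H (s + d + INR i * d))) with
    (Cminus (Cplus (csum n (fun i => H (s + d + INR i * d))) (H s)) (H s)) by ring.
  rewrite E; ring.
Qed.

(** * Fourier modes and half-step translation of the grid *)

Lemma cis_plus (a b : R) : cis (a + b) = Cmult (cis a) (cis b).
Proof.
  unfold cis, Cmult; simpl. rewrite cos_plus, sin_plus. f_equal; ring.
Qed.

Lemma Cmod_cis (a : R) : Cmod (cis a) = 1.
Proof.
  unfold cis, Cmod; simpl. transitivity (sqrt 1); [f_equal | apply sqrt_1].
  generalize (sin2_cos2 a); unfold Rsqr; lra.
Qed.

Definition lipschitz (M : R) (h : R -> C) : Prop :=
  forall x y, Cmod (Cminus (h x) (h y)) <= M * Rabs (x - y).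

Lemma lipschitz_mult_cis (M a : R) (h : R -> C) :
  lipschitz M h -> lipschitz M (fun x => Cmult (h x) (cis a)).
Proof.
  intros H x y.
  replace (Cminus (Cmult (h x) (cis a)) (Cmult (h y) (cis a)))
    with (Cmult (Cminus (h x) (h y)) (cis a)) by ring.
  rewrite Cmod_mult, Cmod_cis, Rmult_1_r. apply H.
Qed.

Lemma lipschitz_comp_minus (M a : R) (h : R -> C) :
  lipschitz M h -> lipschitz M (fun x => h (a - x)).
Proof.
  intros H x y. eapply Rle_trans; [apply H|].
  replace (a - x - (a - y)) with (- (x - y)) by ring. rewrite Rabs_Ropp. lra.
Qed.

(** [Mf] and [Mg] bound both the size and the Lipschitz constant, so each of the two terms of the
    product rule contributes [Mf * Mg]. *)
Lemma lipschitz_mult (Mf Mg : R) (f g : R -> C) :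
  (forall x, Cmod (f x) <= Mf) -> (forall x, Cmod (g x) <= Mg) ->
  lipschitz Mf f -> lipschitz Mg g ->
  lipschitz (2 * Mf * Mg) (fun x => Cmult (f x) (g x)).
Proof.
  intros Bf Bg Lf Lg x y.
  replace (Cminus (Cmult (f x) (g x)) (Cmult (f y) (g y))) with
    (Cplus (Cmult (f x) (Cminus (g x) (g y))) (Cmult (Cminus (f x) (f y)) (g y))) by ring.
  eapply Rle_trans; [apply Cmod_triangle|]. rewrite !Cmod_mult.
  replace (2 * Mf * Mg * Rabs (x - y)) with
    (Mf * (Mg * Rabs (x - y)) + (Mf * Rabs (x - y)) * Mg) by ring.
  apply Rplus_le_compat; apply Rmult_le_compat; auto using Cmod_ge_0.
Qed.

Section HalfStep.

Variables (M : R) (G : R -> C) (K : nat) (k : Z).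
Hypothesis G_lip : lipschitz M G.
Hypothesis G_supp : forall x, / 4 <= Rabs x -> G x = RtoC 0.
Hypothesis K_pos : (1 <= K)%nat.
Hypothesis k_le : (Z.abs k <= Z.of_nat K)%Z.

Let L := (2 * K + 1)%nat.
Let d := / INR L.
Let H (x : R) := Cmult (G x) (cis (- (2 * PI * (IZR k * x)))).
(** As [L * d = 1], the samples form a window of unit length starting at [s]; for [s] in
    [-3/4, -1/4] the interval [s, s + 1] covers the support of [G]. *)
Let W (s : R) := avg L (fun i => H (s + INR i * d)).

Let L_eq : INR L = 2 * INR K + 1.
Proof. unfold L; rewrite plus_INR, mult_INR; simpl; ring. Qed.

Let K_ge1 : 1 <= INR K.
Proof. apply (le_INR 1); assumption. Qed.

Let Ld : INR L * d = 1.
Proof. unfold d; rewrite L_eq; field; lra. Qed.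

Let d_pos : 0 < d.
Proof. unfold d; apply Rinv_0_lt_compat; rewrite L_eq; lra. Qed.

(** The point [s] that leaves the window and the point [s + 1] that enters it both lie where [G]
    vanishes. *)
Lemma window_step (s : R) : - 3 / 4 <= s <= - / 4 -> W (s + d) = W s.
Proof.
  intros Hs. apply avg_shift. rewrite Ld. unfold H.
  rewrite !G_supp; [now rewrite !Cmult_0_l | rewrite Rabs_left1; lra | rewrite Rabs_pos_eq; lra].
Qed.

(** Single steps join any two windows starting at multiples of [d] in the admissible range. The
    reference index [K] is the one with [K * d = 1/2 - d/2], half a step from the centred window. *)
Lemma window_grid (p : nat) : / 4 <= INR p * d <= 3 / 4 -> W (- (INR p * d)) = W (- (INR K * d)).
Proof.
  (* From [2 * K * d + d = 1] and [d <= K * d] one gets [1/3 <= K * d < 1/2]. *)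
  assert (KL : / 4 <= INR K * d <= 3 / 4).
  { assert (INR K * d * 2 + d = 1) by (rewrite <- Ld, L_eq; ring).
    assert (d <= INR K * d) by nra. lra. }
  assert (up : forall q n, / 4 <= INR q * d -> INR (q + n) * d <= 3 / 4 ->
     W (- (INR (q + n) * d)) = W (- (INR q * d))).
  { intros q; induction n as [|n IH]; intros H1 H2; [now rewrite Nat.add_0_r|].
    assert (E : INR (q + S n) = INR (q + n) + 1) by (rewrite Nat.add_succ_r, S_INR; ring).
    rewrite E in *. rewrite <- IH by lra.
    rewrite <- (window_step (- ((INR (q + n) + 1) * d))); [f_equal; ring|].
    assert (INR q <= INR (q + n)) by (apply le_INR; lia).
    assert (INR q * d <= INR (q + n) * d) by (apply Rmult_le_compat_r; lra). lra. }
  intros Hp. destruct (le_ge_dec p K) as [h|h].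
  - replace K with (p + (K - p))%nat at 1 by lia. symmetry; apply up; [lra|].
    replace (p + (K - p))%nat with K by lia. lra.
  - replace p with (K + (p - K))%nat by lia. apply up; [lra|].
    replace (K + (p - K))%nat with p by lia. lra.
Qed.

(** The phase [exp (- i pi k / L)] that the mode acquires over half a grid step. *)
Let w := cis (- (2 * PI * (IZR k * (d / 2)))).

(** The mode is translated exactly, at the cost of the factor [w]; only the slowly varying [G] is
    estimated by its Lipschitz constant. *)
Lemma window_half_step (s : R) : Cmod (Cminus (W (s + d / 2)) (Cmult w (W s))) <= M * (d / 2).
Proof.
  unfold W at 2. rewrite <- avg_scal. apply avg_dist_le; [unfold L; lia|].
  intros i _. unfold H.
  replace (- (2 * PI * (IZR k * (s + d / 2 + INR i * d)))) with
    (- (2 * PI * (IZR k * (d / 2))) + - (2 * PI * (IZR k * (s + INR i * d)))) by field.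
  rewrite cis_plus. fold w.
  replace (Cminus _ _) with (Cmult (Cminus (G (s + d / 2 + INR i * d)) (G (s + INR i * d)))
    (Cmult w (cis (- (2 * PI * (IZR k * (s + INR i * d))))))) by ring.
  rewrite !Cmod_mult. unfold w; rewrite !Cmod_cis, !Rmult_1_r.
  eapply Rle_trans; [apply G_lip|].
  replace (s + d / 2 + INR i * d - (s + INR i * d)) with (d / 2) by field.
  rewrite (Rabs_pos_eq (d / 2)) by lra. lra.
Qed.

(** Since [|k| <= K < L / 2], the angle of [w] stays within a right angle, so [w] has nonnegative
    real part and [1 + w] has real part at least 1. *)
Lemma Cmod_one_plus_half_step_mode : 1 <= Cmod (Cplus (RtoC 1) w).
Proof.
  assert (B : Rabs (IZR k) <= INR K).
  { rewrite <- abs_IZR, INR_IZR_INZ. now apply IZR_le. }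
  assert (Kd : INR K * d <= / 2) by (assert (INR K * d * 2 + d = 1) by (rewrite <- Ld, L_eq; ring); lra).
  assert (0 <= cos (- (2 * PI * (IZR k * (d / 2))))).
  { apply Rabs_le_between in B.
    assert (- / 2 <= IZR k * d <= / 2).
    { split; [apply Rle_trans with (- INR K * d) | apply Rle_trans with (INR K * d)]; try lra;
        apply Rmult_le_compat_r; lra. }
    assert (P := PI_RGT_0).
    assert (- (/ 2 * PI) <= IZR k * d * PI <= / 2 * PI).
    { split; [replace (- (/ 2 * PI)) with (- / 2 * PI) by ring|]; apply Rmult_le_compat_r; lra. }
    apply cos_ge_0; lra. }
  eapply Rle_trans; [|apply re_le_Cmod].
  unfold w, cis, Re, Cplus; simpl. rewrite Rabs_pos_eq; lra.
Qed.

Lemma window_centered : Cmod (Cminus (W (- (INR K * d))) (W (- / 2))) <= M / INR L.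
Proof.
  assert (Dd : d <= / 3).
  { unfold d. apply Rinv_le_contravar; rewrite ?L_eq; lra. }
  assert (E : - / 2 + d / 2 = - (INR K * d))
    by (replace (/ 2) with (INR L * d / 2) by (rewrite Ld; field); rewrite L_eq; field).
  assert (H1 := window_half_step (- / 2)). rewrite E in H1.
  (* A second half step completes a full step from [- / 2], which leaves [W] unchanged; so [H1] and
     [H2] bound [b - w a] and [a - w b]. *)
  assert (H2 := window_half_step (- (INR K * d))).
  replace (- (INR K * d) + d / 2) with (- / 2 + d) in H2 by lra.
  rewrite window_step in H2 by lra.
  set (a := W (- / 2)) in *. set (b := W (- (INR K * d))) in *.
  assert (Hs : Cmod (Cmult (Cplus (RtoC 1) w) (Cminus b a)) <= M * d).
  { replace (Cmult _ _) with (Cplus (Cminus b (Cmult w a)) (Copp (Cminus a (Cmult w b)))) by ring.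
    eapply Rle_trans; [apply Cmod_triangle|]. rewrite Cmod_opp. lra. }
  rewrite Cmod_mult in Hs. change (M / INR L) with (M * d).
  assert (P := Cmod_one_plus_half_step_mode). assert (Q := Cmod_ge_0 (Cminus b a)).
  nra.
Qed.

(** The differences [X i - X p] form the window starting at [- (p * d)], and [Rabs (X p) <= / 4]
    says exactly that [p * d] lies in [1/4, 3/4]. *)
Lemma grid_difference_avg (p : nat) :
  let X i := - / 2 + INR i / INR L in
  Rabs (X p) <= / 4 ->
  Cmod (Cminus (avg L (fun i => H (X i - X p))) (avg L (fun i => H (X i)))) <= M / INR L.
Proof.
  intros X Hp.
  replace (avg L (fun i => H (X i - X p))) with (W (- (INR p * d))).
  - rewrite window_grid; [apply window_centered|].
    apply Rabs_le_between in Hp. unfold X, Rdiv in Hp. fold d in Hp. lra.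
  - apply avg_ext; intros i _. f_equal. unfold X, Rdiv; fold d; ring.
Qed.

End HalfStep.

(** In a periodic variable, differences of grid points are grid points again modulo [P], so
    recentering is exact. *)
Lemma periodic_grid_difference_avg (H : R -> C) (n p : nat) (P : R) :
  (0 < n)%nat -> (forall t, H (t + P) = H t) ->
  avg n (fun i => H (P * INR i / INR n - P * INR p / INR n)) =
  avg n (fun i => H (P * INR i / INR n)).
Proof.
  intros Hn HP. apply lt_INR in Hn; simpl in Hn.
  set (d := P / INR n).
  assert (E : forall s, avg n (fun i => H (s + d + INR i * d)) = avg n (fun i => H (s + INR i * d))).
  { intros s; apply avg_shift. replace (INR n * d) with P by (unfold d; field; lra). apply HP. }
  transitivity (avg n (fun i => H (- (INR p * d) + INR i * d))).
  { apply avg_ext; intros; f_equal; unfold d; field; lra. }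
  induction p as [|p IH].
  - apply avg_ext; intros; f_equal; unfold d; simpl; field; lra.
  - rewrite <- IH, <- E. apply avg_ext; intros; rewrite S_INR; f_equal; ring.
Qed.

(** * Integrals of Lipschitz functions *)

Notation CV := C_R_CompleteNormedModule.

Lemma norm_CV (z : C) : @norm R_AbsRing CV z = Cmod z.
Proof.
  unfold norm; simpl. unfold prod_norm, Cmod, norm; simpl. unfold abs; simpl.
  f_equal; rewrite !Rmult_1_r, <- !Rabs_mult, !Rabs_pos_eq by nra. reflexivity.
Qed.

Lemma scal_CV (r : R) (z : C) : @scal R_AbsRing CV r z = Cmult (RtoC r) z.
Proof.
  unfold scal; simpl. unfold prod_scal, Cmult, scal; simpl. unfold mult; simpl.
  f_equal; ring.
Qed.

Lemma lipschitz_continuous (M : R) (h : R -> C) (x : R) :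
  lipschitz M h -> @continuous R_UniformSpace CV h x.
Proof.
  intros H. apply filterlim_locally; intros eps.
  (* [M] carries no sign condition; [Rabs M + 1] is a positive divisor. *)
  assert (HM : 0 < Rabs M + 1) by (generalize (Rabs_pos M); lra).
  exists (mkposreal _ (Rdiv_lt_0_compat _ _ (cond_pos eps) HM)); intros y Hy.
  change (Rabs (y - x) < eps / (Rabs M + 1)) in Hy.
  apply (@norm_compat1 R_AbsRing CV). rewrite norm_CV.
  eapply Rle_lt_trans; [apply H|].
  apply Rle_lt_trans with ((Rabs M + 1) * Rabs (y - x)).
  - apply Rmult_le_compat_r; [apply Rabs_pos|]. generalize (Rle_abs M); lra.
  - apply Rmult_lt_compat_l with (r := Rabs M + 1) in Hy; [|assumption].
    replace ((Rabs M + 1) * (eps / (Rabs M + 1))) with (pos eps) in Hy by (field; lra).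
    exact Hy.
Qed.

Lemma lipschitz_ex_RInt (M : R) (h : R -> C) (a b : R) :
  lipschitz M h -> @ex_RInt CV h a b.
Proof.
  intros H. apply (@ex_RInt_continuous CV); intros; now apply lipschitz_continuous with M.
Qed.

Lemma RInt_dist_le (M N : R) (g h : R -> C) (a b e : R) :
  a <= b -> lipschitz M g -> lipschitz N h ->
  (forall x, a <= x <= b -> Cmod (Cminus (g x) (h x)) <= e) ->
  Cmod (Cminus (@RInt CV g a b) (@RInt CV h a b)) <= (b - a) * e.
Proof.
  intros Hab Hg Hh He.
  assert (Eg := lipschitz_ex_RInt M g a b Hg). assert (Eh := lipschitz_ex_RInt N h a b Hh).
  rewrite <- norm_CV.
  apply (@norm_RInt_le_const CV (fun x => Cminus (g x) (h x)) a b); [assumption| |].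
  - intros x Hx. rewrite norm_CV. now apply He.
  - apply (@is_RInt_minus CV g h); apply (@RInt_correct CV); assumption.
Qed.

Lemma lipschitz_const (z : C) : lipschitz 0 (fun _ => z).
Proof. intros x y. replace (Cminus z z) with (RtoC 0) by ring. rewrite Cmod_0; lra. Qed.

(** With [d = (b - a) / n], freezing [h] at the left end of a cell costs at most [M * d] pointwise,
    hence [M * d ^ 2] per cell; there are [n] cells. *)
Lemma riemann_sum_error (M : R) (h : R -> C) (a b : R) (n : nat) :
  (0 < n)%nat -> a <= b -> lipschitz M h ->
  Cmod (Cminus (@RInt CV h a b)
    (Cmult (RtoC (b - a)) (avg n (fun i => h (a + INR i * ((b - a) / INR n))))))
  <= (b - a) ^ 2 * M / INR n.
Proof.
  intros Hn Hab Hh. apply lt_INR in Hn; simpl in Hn.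
  set (d := (b - a) / INR n).
  assert (Hd : 0 <= d) by (apply Rdiv_le_0_compat; lra).
  assert (E : forall m, Cmod (Cminus (@RInt CV h a (a + INR m * d))
     (Cmult (RtoC d) (csum m (fun i => h (a + INR i * d))))) <= INR m * (d * (M * d))).
  { induction m as [|m IH].
    - simpl. rewrite !Rmult_0_l, Rplus_0_r, (@RInt_point CV). unfold csum; simpl.
      change (@zero CV) with (RtoC 0). rewrite Cmult_0_r.
      replace (Cminus (RtoC 0) (RtoC 0)) with (RtoC 0) by ring. rewrite Cmod_0; lra.
    - rewrite csum_S, S_INR.
      rewrite <- (@RInt_Chasles CV h a (a + INR m * d)) by now apply lipschitz_ex_RInt with M.
      set (I1 := @RInt CV h a (a + INR m * d)) in *.
      set (I2 := @RInt CV h (a + INR m * d) (a + (INR m + 1) * d)).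
      change (@plus CV I1 I2) with (Cplus I1 I2).
      set (S1 := csum m _) in *.
      replace (Cminus _ _) with (Cplus (Cminus I1 (Cmult (RtoC d) S1))
        (Cminus I2 (Cmult (RtoC d) (h (a + INR m * d))))) by ring.
      eapply Rle_trans; [apply Cmod_triangle|].
      replace ((INR m + 1) * (d * (M * d))) with (INR m * (d * (M * d)) + d * (M * d)) by ring.
      apply Rplus_le_compat; [exact IH|].
      (* The term of the sum becomes the integral of a constant over the last cell, so that two
         integrals are compared. *)
      replace (Cmult (RtoC d) (h (a + INR m * d))) with
        (@RInt CV (fun _ => h (a + INR m * d)) (a + INR m * d) (a + (INR m + 1) * d))
        by (rewrite (@RInt_const CV), scal_CV; f_equal; f_equal; ring).
      replace (d * (M * d)) with (((a + (INR m + 1) * d) - (a + INR m * d)) * (M * d)) by ring.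
      apply RInt_dist_le with M 0; [lra|assumption|apply lipschitz_const|].
      intros x Hx. eapply Rle_trans; [apply Hh|].
      (* A Lipschitz constant is nonnegative, as two points at distance 1 show. *)
      assert (HM : 0 <= M).
      { assert (H01 := Hh 1 0). rewrite Rminus_0_r, Rabs_R1 in H01.
        generalize (Cmod_ge_0 (Cminus (h 1) (h 0))); lra. }
      apply Rmult_le_compat_l; [assumption|].
      rewrite Rabs_pos_eq; lra. }
  specialize (E n).
  replace (a + INR n * d) with b in E by (unfold d; field; lra).
  replace (INR n * (d * (M * d))) with ((b - a) ^ 2 * M / INR n) in E by (unfold d; field; lra).
  replace (Cmult (RtoC (b - a)) (avg n (fun i => h (a + INR i * d)))) with
    (Cmult (RtoC d) (csum n (fun i => h (a + INR i * d)))); [exact E|].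
  unfold avg. rewrite Cmult_assoc, <- RtoC_mult. reflexivity.
Qed.

(** Once the endpoints pass [- / 2] and [/ 2] the integral no longer changes, so the limit is
    attained and not merely approached. *)
Lemma RInt_gen_compact_support (M : R) (h : R -> C) :
  lipschitz M h -> (forall x, / 4 <= Rabs x -> h x = RtoC 0) ->
  @RInt_gen CV h (Rbar_locally m_infty) (Rbar_locally p_infty) = @RInt CV h (- / 2) (/ 2).
Proof.
  intros Hh Hs. apply (is_RInt_gen_unique (V := CV)).
  assert (Z : forall a b, a <= b -> (forall x, a < x < b -> / 4 <= Rabs x) -> @is_RInt CV h a b (@zero CV)).
  { intros a b Hab Hx.
    apply (@is_RInt_ext CV (fun _ => @zero CV)).
    - intros x. rewrite Rmin_left, Rmax_right by assumption. intros; symmetry; now apply Hs, Hx.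
    - assert (E := @is_RInt_const CV a b (RtoC 0)). rewrite scal_CV, Cmult_0_r in E. exact E. }
  apply (filterlimi_locally (U := CV)); intros eps.
  apply Filter_prod with (fun a => a < - / 2) (fun b => / 2 < b).
  - now exists (- / 2).
  - now exists (/ 2).
  - intros a b Ha Hb. simpl. exists (@RInt CV h (- / 2) (/ 2)). split; [|apply ball_center].
    set (I := @RInt CV h (- / 2) (/ 2)).
    assert (E : @plus CV (@plus CV (@zero CV) I) (@zero CV) = I)
      by (change (Cplus (Cplus (RtoC 0) I) (RtoC 0) = I); ring).
    rewrite <- E.
    apply (@is_RInt_Chasles CV) with (/ 2); [apply (@is_RInt_Chasles CV) with (- / 2)|].
    + apply Z; [lra|]. intros x Hx; rewrite Rabs_left; lra.
    + apply (@RInt_correct CV). now apply lipschitz_ex_RInt with M.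
    + apply Z; [lra|]. intros x Hx; rewrite Rabs_pos_eq; lra.
Qed.

Lemma RInt_gen_riemann_sum_error (M : R) (h : R -> C) (n : nat) :
  (0 < n)%nat -> lipschitz M h -> (forall x, / 4 <= Rabs x -> h x = RtoC 0) ->
  Cmod (Cminus (@RInt_gen CV h (Rbar_locally m_infty) (Rbar_locally p_infty))
    (avg n (fun i => h (- / 2 + INR i / INR n)))) <= M / INR n.
Proof.
  intros Hn Hh Hs. rewrite (RInt_gen_compact_support M) by assumption.
  assert (E := riemann_sum_error M h (- / 2) (/ 2) n Hn ltac:(lra) Hh).
  replace (/ 2 - - / 2) with 1 in E by field.
  rewrite Cmult_1_l in E.
  replace (1 ^ 2 * M / INR n) with (M / INR n) in E by (unfold Rdiv; ring).
  rewrite (avg_ext n _ (fun i => h (- / 2 + INR i * (1 / INR n)))); [exact E|].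
  intros; f_equal; unfold Rdiv; ring.
Qed.

(** * Riemann sums for the Haar integral on SE(2) *)

Section SE2Riemann.

Variables (M : R) (F : SE2fun).
Hypothesis F_lip1 : forall y t, lipschitz M (fun x => F x y t).
Hypothesis F_lip2 : forall x t, lipschitz M (fun y => F x y t).
Hypothesis F_lip3 : forall x y, lipschitz M (fun t => F x y t).
Hypothesis F_supp : forall x y t, / 4 <= Rabs x \/ / 4 <= Rabs y -> F x y t = RtoC 0.

Let I1 x y := @RInt CV (fun t => F x y t) 0 (2 * PI).
Let I2 x := @RInt_gen CV (fun y => I1 x y) (Rbar_locally m_infty) (Rbar_locally p_infty).

(** Partial integrals stay Lipschitz, with the length [2 * PI] as extra factor, so the Riemann
    estimate applies again to the outer variables. *)
Let I1_lip1 y : lipschitz (2 * PI * M) (fun x => I1 x y).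
Proof.
  assert (P := PI_RGT_0). intros x x'. unfold I1.
  replace (2 * PI * M * Rabs (x - x')) with ((2 * PI - 0) * (M * Rabs (x - x'))) by ring.
  apply RInt_dist_le with M M; auto; [lra|]. intros t _; apply F_lip1.
Qed.

Let I1_lip2 x : lipschitz (2 * PI * M) (fun y => I1 x y).
Proof.
  assert (P := PI_RGT_0). intros y y'. unfold I1.
  replace (2 * PI * M * Rabs (y - y')) with ((2 * PI - 0) * (M * Rabs (y - y'))) by ring.
  apply RInt_dist_le with M M; auto; [lra|]. intros t _; apply F_lip2.
Qed.

Let I1_supp x y : / 4 <= Rabs x \/ / 4 <= Rabs y -> I1 x y = RtoC 0.
Proof.
  intros H. unfold I1.
  rewrite (@RInt_ext CV _ (fun _ => RtoC 0)) by (intros; now apply F_supp).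
  rewrite (@RInt_const CV), scal_CV. apply Cmult_0_r.
Qed.

Let I2_eq x : I2 x = @RInt CV (fun y => I1 x y) (- / 2) (/ 2).
Proof.
  exact (RInt_gen_compact_support (2 * PI * M) (fun y => I1 x y) (I1_lip2 x)
    (fun y Hy => I1_supp x y (or_intror Hy))).
Qed.

Let I2_lip : lipschitz (2 * PI * M) I2.
Proof.
  intros x x'. rewrite !I2_eq.
  replace (2 * PI * M * Rabs (x - x')) with ((/ 2 - - / 2) * (2 * PI * M * Rabs (x - x'))) by field.
  apply RInt_dist_le with (2 * PI * M) (2 * PI * M); auto; [lra|]. intros y _; apply I1_lip1.
Qed.

Let I2_supp x : / 4 <= Rabs x -> I2 x = RtoC 0.
Proof.
  intros H. rewrite I2_eq.
  rewrite (@RInt_ext CV _ (fun _ => RtoC 0)) by (intros; apply I1_supp; now left).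
  rewrite (@RInt_const CV), scal_CV. apply Cmult_0_r.
Qed.

(** The integrals are discretised one at a time, outermost first. The Haar factor [/ (2 * PI)]
    cancels the [2 * PI] in the Lipschitz constants of [I1] and [I2]; in the angle it reduces
    [(2 * PI) ^ 2] to [2 * PI]. *)
Lemma SE2_integral_riemann_sum_error (Lx Ly Lr : nat) :
  (0 < Lx)%nat -> (0 < Ly)%nat -> (0 < Lr)%nat ->
  Cmod (Cminus (SE2_integral F)
    (avg Lx (fun i => avg Ly (fun j => avg Lr (fun l =>
       F (- / 2 + INR i / INR Lx) (- / 2 + INR j / INR Ly) (2 * PI * INR l / INR Lr))))))
  <= M / INR Lx + M / INR Ly + 2 * PI * M / INR Lr.
Proof.
  intros Hx Hy Hr. assert (P := PI_RGT_0).
  assert (sc : forall z u (e : R), Cmod (Cminus z u) <= 2 * PI * e ->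
     Cmod (Cminus (Cmult (RtoC (/ (2 * PI))) z) (Cmult (RtoC (/ (2 * PI))) u)) <= e).
  { intros z u e H.
    replace (Cminus _ _) with (Cmult (RtoC (/ (2 * PI))) (Cminus z u)) by ring.
    rewrite Cmod_mult, Cmod_R, Rabs_pos_eq by (left; apply Rinv_0_lt_compat; lra).
    apply Rmult_le_reg_l with (2 * PI); [lra|].
    rewrite <- Rmult_assoc, Rinv_r, Rmult_1_l by lra. exact H. }
  change (SE2_integral F) with (Cmult (RtoC (/ (2 * PI)))
    (@RInt_gen CV I2 (Rbar_locally m_infty) (Rbar_locally p_infty))).
  rewrite Rplus_assoc.
  apply Cmod_minus_trans with
    (Cmult (RtoC (/ (2 * PI))) (avg Lx (fun i => I2 (- / 2 + INR i / INR Lx)))).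
  { apply sc. replace (2 * PI * (M / INR Lx)) with (2 * PI * M / INR Lx) by (unfold Rdiv; ring).
    exact (RInt_gen_riemann_sum_error (2 * PI * M) I2 Lx Hx I2_lip I2_supp). }
  rewrite <- avg_scal. apply avg_dist_le; [assumption|]; intros i _.
  set (x := - / 2 + INR i / INR Lx).
  apply Cmod_minus_trans with
    (Cmult (RtoC (/ (2 * PI))) (avg Ly (fun j => I1 x (- / 2 + INR j / INR Ly)))).
  { apply sc. replace (2 * PI * (M / INR Ly)) with (2 * PI * M / INR Ly) by (unfold Rdiv; ring).
    exact (RInt_gen_riemann_sum_error (2 * PI * M) (fun y => I1 x y) Ly Hy (I1_lip2 x)
      (fun y Hy => I1_supp x y (or_intror Hy))). }
  rewrite <- avg_scal. apply avg_dist_le; [assumption|]; intros j _.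
  set (y := - / 2 + INR j / INR Ly).
  assert (E := riemann_sum_error M (fun t => F x y t) 0 (2 * PI) Lr Hr ltac:(lra) (F_lip3 x y)).
  rewrite Rminus_0_r in E. fold (I1 x y) in E.
  replace (avg Lr (fun l => F x y (2 * PI * INR l / INR Lr))) with
    (Cmult (RtoC (/ (2 * PI))) (Cmult (RtoC (2 * PI))
       (avg Lr (fun i => F x y (0 + INR i * (2 * PI / INR Lr)))))).
  - apply sc. eapply Rle_trans; [exact E|]. right. unfold Rdiv; ring.
  - rewrite Cmult_assoc, <- RtoC_mult, Rinv_l, Cmult_1_l by lra.
    apply avg_ext; intros; f_equal; unfold Rdiv; ring.
Qed.

End SE2Riemann.

(** * Uniform Lipschitz bounds for compactly supported functions of class C1 *)

(** Compactness of [a, b]: a property that holds locally at some scale, and persists at smaller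
    scales, holds at one scale throughout. *)
Lemma compact_uniform_scale (P : R -> R -> Prop) (a b : R) :
  (forall x d d', 0 < d' <= d -> P x d -> P x d') ->
  (forall x, exists d, 0 < d /\ forall x', Rabs (x' - x) < d -> P x' d) ->
  exists d, 0 < d /\ forall x, a <= x <= b -> P x d.
Proof.
  intros mono loc.
  set (del := fun x => proj1_sig (constructive_indefinite_description _ (loc x))).
  assert (Hdel : forall x, 0 < del x /\ forall x', Rabs (x' - x) < del x -> P x' (del x))
    by (intros x; exact (proj2_sig (constructive_indefinite_description _ (loc x)))).
  destruct (compactness_value_1d a b (fun x => mkposreal _ (proj1 (Hdel x)))) as [d Hd].
  exists d; split; [apply cond_pos|]. intros x Hx.
  (* Compactness yields, under a double negation, a tag [t] with [x] within [del t] of it and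
     [d <= del t]. *)
  destruct (NNPP _ (Hd x Hx)) as [t [_ [Ht Hdt]]]; simpl in *.
  apply mono with (del t); [split; [apply cond_pos | assumption]|].
  now apply (proj2 (Hdel t)).
Qed.

(* A single scale [d] serves both as the radius of the neighbourhoods and, through the bound [/ d],
   as the size of the function, so that one monotone parameter goes through the three variables. *)
Lemma continuous3_bounded_on_box (h : R -> R -> R -> R) (a : R) :
  continuous3 h -> exists M, forall x y t,
    - a <= x <= a -> - a <= y <= a -> - a <= t <= a -> Rabs (h x y t) <= M.
Proof.
  intros Hc.
  assert (inv : forall d d' r, 0 < d' <= d -> r <= / d -> r <= / d').
  { intros d d' r Hd Hr. apply Rle_trans with (1 := Hr). apply Rinv_le_contravar; lra. }
  (* [S0] is the local bound. [S1] lets the third variable run over the whole interval, [S2] the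
     second as well, and a last use of compactness the first. *)
  assert (S0 : forall x y t, exists d, 0 < d /\ forall t', Rabs (t' - t) < d ->
    forall x' y', Rabs (x' - x) < d -> Rabs (y' - y) < d -> Rabs (h x' y' t') <= / d).
  { intros x y t. destruct (Hc x y t 1 Rlt_0_1) as [d [Hd Hb]].
    set (B := Rabs (h x y t) + 1).
    assert (HB : 0 < B) by (unfold B; generalize (Rabs_pos (h x y t)); lra).
    exists (Rmin d (/ B)). split; [apply Rmin_pos; [|apply Rinv_0_lt_compat]; assumption|].
    intros t' Ht x' y' Hx Hy.
    assert (l := Rmin_l d (/ B)). assert (r := Rmin_r d (/ B)).
    apply inv with (/ B).
    - split; [apply Rmin_pos; [|apply Rinv_0_lt_compat]; assumption | assumption].
    - rewrite Rinv_inv.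
      assert (E : Rabs (h x' y' t' - h x y t) < 1) by (apply Hb; lra).
      generalize (Rabs_triang (h x' y' t' - h x y t) (h x y t)).
      replace (h x' y' t' - h x y t + h x y t) with (h x' y' t') by ring.
      unfold B; lra. }
  assert (S1 : forall x y, exists d, 0 < d /\ forall y', Rabs (y' - y) < d ->
    forall x' t', Rabs (x' - x) < d -> - a <= t' <= a -> Rabs (h x' y' t') <= / d).
  { intros x y.
    destruct (compact_uniform_scale (fun t' d => forall x' y', Rabs (x' - x) < d ->
      Rabs (y' - y) < d -> Rabs (h x' y' t') <= / d) (- a) a) as [d [Hd Hb]].
    - intros t d d' Hd H x' y' Hx Hy. apply inv with d; [assumption|]. apply H; lra.
    - apply S0.
    - exists d; split; auto. }
  assert (S2 : forall x, exists d, 0 < d /\ forall x', Rabs (x' - x) < d ->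
    forall y' t', - a <= y' <= a -> - a <= t' <= a -> Rabs (h x' y' t') <= / d).
  { intros x.
    destruct (compact_uniform_scale (fun y' d => forall x' t', Rabs (x' - x) < d ->
      - a <= t' <= a -> Rabs (h x' y' t') <= / d) (- a) a) as [d [Hd Hb]].
    - intros y d d' Hd H x' t' Hx Ht. apply inv with d; [assumption|]. apply H; [lra|assumption].
    - apply S1.
    - exists d; split; auto. }
  destruct (compact_uniform_scale (fun x' d => forall y' t',
    - a <= y' <= a -> - a <= t' <= a -> Rabs (h x' y' t') <= / d) (- a) a) as [d [Hd Hb]].
  - intros x d d' Hd H y' t' Hy Ht. apply inv with d; [assumption|]. now apply H.
  - apply S2.
  - exists (/ d); auto.
Qed.

(** Moving by one period towards the origin brings any [t] into [-P, P] after finitely many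
    moves. *)
Lemma periodic_bounded (h : R -> R) (P M : R) :
  0 < P -> (forall t, h (t + P) = h t) -> (forall t, - P <= t <= P -> Rabs (h t) <= M) ->
  forall t, Rabs (h t) <= M.
Proof.
  intros HP Hper HM.
  assert (E : forall n t, - (INR n * P) <= t <= INR n * P -> Rabs (h t) <= M).
  { induction n as [|n IH]; intros t Ht.
    - simpl in Ht. apply HM. lra.
    - rewrite S_INR in Ht. assert (0 <= INR n) by apply pos_INR.
      assert (0 <= INR n * P) by (apply Rmult_le_pos; lra).
      destruct (Rle_lt_dec t 0) as [h0|h0].
      + destruct (Rle_lt_dec (- P) t) as [h1|h1]; [apply HM; lra|].
        rewrite <- Hper. apply IH; lra.
      + destruct (Rle_lt_dec t P) as [h1|h1]; [apply HM; lra|].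
        replace t with ((t - P) + P) by ring. rewrite Hper. apply IH; lra. }
  intros t. destruct (INR_unbounded (Rabs t / P)) as [n Hn].
  apply (E n). apply Rabs_le_between. apply Rmult_le_reg_r with (/ P); [now apply Rinv_0_lt_compat|].
  rewrite Rmult_assoc, Rinv_r, Rmult_1_r by lra. unfold Rdiv in Hn; lra.
Qed.

Lemma is_derive_locally_zero (g : R -> R) (x l e : R) :
  0 < e -> (forall u, Rabs (u - x) < e -> g u = 0) -> is_derive g x l -> l = 0.
Proof.
  intros He Hg Hl. rewrite <- (is_derive_unique _ _ _ Hl). apply is_derive_unique.
  apply is_derive_ext_loc with (fun _ => 0).
  - exists (mkposreal e He); intros u Hu. symmetry. now apply Hg.
  - apply (@is_derive_const R_AbsRing R_NormedModule 0 x).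
Qed.

Lemma derive_bounded_lipschitz (g g' : R -> R) (M : R) :
  (forall x, is_derive g x (g' x)) -> (forall x, Rabs (g' x) <= M) ->
  forall x y, Rabs (g x - g y) <= M * Rabs (x - y).
Proof.
  intros Hd HM x y.
  destruct (MVT_gen g y x g') as [c [_ Hc]].
  - intros; apply Hd.
  - intros z _. apply derivable_continuous_pt. exists (g' z). apply is_derive_Reals, Hd.
  - rewrite Hc, Rabs_mult. apply Rmult_le_compat_r; [apply Rabs_pos | apply HM].
Qed.

Lemma continuous3_bounded (h : R -> R -> R -> R) :
  continuous3 h -> (forall x y t, h x y (t + 2 * PI) = h x y t) ->
  (forall x y t, 1 < Rabs x \/ 1 < Rabs y -> h x y t = 0) ->
  exists M, forall x y t, Rabs (h x y t) <= M.
Proof.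
  intros Hc Hp Hs. assert (P := PI_RGT_0). assert (P4 := PI2_1).
  (* The half-width [2 * PI] exceeds 1 and so also covers the region where [h] may be nonzero. *)
  destruct (continuous3_bounded_on_box h (2 * PI) Hc) as [M HM].
  exists M. intros x y t.
  apply (periodic_bounded (fun t => h x y t) (2 * PI)); [lra | apply Hp |].
  clear t; intros t Ht.
  assert (M0 : 0 <= M).
  { eapply Rle_trans; [apply Rabs_pos | apply (HM 0 0 0); lra]. }
  destruct (Rlt_le_dec 1 (Rabs x)) as [h1|h1]; [rewrite Hs, Rabs_R0 by auto; lra|].
  destruct (Rlt_le_dec 1 (Rabs y)) as [h2|h2]; [rewrite Hs, Rabs_R0 by auto; lra|].
  apply Rabs_le_between in h1, h2. apply HM; lra.
Qed.

(** Gives a whole neighbourhood of [x] on which the function vanishes, so that its derivatives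
    vanish at [x] too. *)
Lemma far_from_support (x u : R) : 1 < Rabs x -> Rabs (u - x) < / 2 -> / 4 <= Rabs u.
Proof.
  intros Hx Hu. generalize (Rabs_triang (x - u) u).
  replace (x - u + u) with x by ring. rewrite (Rabs_minus_sym x u). lra.
Qed.

Section RealLipschitz.

Variable g : R -> R -> R -> R.
Hypothesis g_C1 : C1_real g.
Hypothesis g_per : forall x y t, g x y (t + 2 * PI) = g x y t.
Hypothesis g_supp : forall x y t, / 4 <= Rabs x \/ / 4 <= Rabs y -> g x y t = 0.

(** The partial derivatives inherit periodicity and vanish for [|x| > 1] or [|y| > 1], hence are
    bounded; the mean value theorem then gives the Lipschitz bounds. *)
Lemma C1_real_lipschitz : exists M, 0 <= M /\ forall x y t,
  Rabs (g x y t) <= M /\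
  (forall x', Rabs (g x y t - g x' y t) <= M * Rabs (x - x')) /\
  (forall y', Rabs (g x y t - g x y' t) <= M * Rabs (y - y')) /\
  (forall t', Rabs (g x y t - g x y t') <= M * Rabs (t - t')).
Proof.
  destruct g_C1 as [gx [gy [gt [Dx [Dy [Dt [Cx [Cy Ct]]]]]]]].
  assert (Bx : exists M, forall x y t, Rabs (gx x y t) <= M).
  { apply continuous3_bounded; [assumption| |].
    - intros x y t. rewrite <- (is_derive_unique _ _ _ (Dx x y t)). symmetry.
      apply is_derive_unique. apply is_derive_ext with (2 := Dx x y (t + 2 * PI)).
      intros; apply g_per.
    - intros x y t H. apply (is_derive_locally_zero _ x _ (/ 2)) with (3 := Dx x y t); [lra|].
      intros u Hu. apply g_supp. destruct H as [H|H]; [left|right; lra].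
      now apply far_from_support with x. }
  assert (By : exists M, forall x y t, Rabs (gy x y t) <= M).
  { apply continuous3_bounded; [assumption| |].
    - intros x y t. rewrite <- (is_derive_unique _ _ _ (Dy x y t)). symmetry.
      apply is_derive_unique. apply is_derive_ext with (2 := Dy x y (t + 2 * PI)).
      intros; apply g_per.
    - intros x y t H. apply (is_derive_locally_zero _ y _ (/ 2)) with (3 := Dy x y t); [lra|].
      intros u Hu. apply g_supp. destruct H as [H|H]; [left; lra|right].
      now apply far_from_support with y. }
  assert (Bt : exists M, forall x y t, Rabs (gt x y t) <= M).
  { apply continuous3_bounded; [assumption| |].
    - intros x y t. rewrite <- (is_derive_unique _ _ _ (Dt x y t)). symmetry.
      apply is_derive_unique. apply is_derive_ext with (fun u => g x y (u + 2 * PI)); [intros; apply g_per|].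
      rewrite <- (scal_one (gt x y (t + 2 * PI))).
      apply (is_derive_comp (fun u => g x y u) (fun u => u + 2 * PI)); [apply Dt|].
      auto_derive; [trivial | reflexivity].
    - intros x y t H. apply (is_derive_locally_zero _ t _ (/ 2)) with (3 := Dt x y t); [lra|].
      intros u Hu. apply g_supp. destruct H; [left|right]; lra. }
  destruct Bx as [Mx Bx], By as [My By], Bt as [Mt Bt].
  set (M := Rmax Mx (Rmax My Mt)).
  assert (lx : Mx <= M) by apply Rmax_l.
  assert (ly : My <= M) by (eapply Rle_trans; [apply Rmax_l | apply Rmax_r]).
  assert (lt : Mt <= M) by (eapply Rle_trans; [apply Rmax_r | apply Rmax_r]).
  assert (M0 : 0 <= M) by (generalize (Rabs_pos (gx 0 0 0)) (Bx 0 0 0); lra).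
  assert (Lx : forall x y t x', Rabs (g x y t - g x' y t) <= M * Rabs (x - x')).
  { intros x y t x'. apply (derive_bounded_lipschitz (fun u => g u y t) (fun u => gx u y t)); auto.
    intros u; apply Rle_trans with (1 := Bx u y t); assumption. }
  (* The factor 2 makes the constant bound [g] itself too: [g] vanishes at first coordinate 1, which
     is at distance less than 2 when [|x| < 1/4]. *)
  exists (2 * M). split; [lra|]. intros x y t.
  assert (dbl : forall r, M * Rabs r <= 2 * M * Rabs r)
    by (intros r; assert (0 <= M * Rabs r) by (apply Rmult_le_pos; [lra | apply Rabs_pos]); lra).
  repeat split.
  - destruct (Rle_lt_dec (/ 4) (Rabs x)) as [h|h]; [rewrite g_supp, Rabs_R0 by auto; lra|].
    generalize (Lx x y t 1). rewrite (g_supp 1) by (left; rewrite Rabs_R1; lra).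
    rewrite Rminus_0_r. intros H; eapply Rle_trans; [exact H|].
    rewrite Rmult_comm. apply Rmult_le_compat_r; [lra|].
    apply Rabs_def2 in h. apply Rabs_le; lra.
  - intros x'; eapply Rle_trans; [apply Lx | apply dbl].
  - intros y'; eapply Rle_trans; [|apply dbl].
    apply (derive_bounded_lipschitz (fun u => g x u t) (fun u => gy x u t)); auto.
    intros u; apply Rle_trans with (1 := By x u t); assumption.
  - intros t'; eapply Rle_trans; [|apply dbl].
    apply (derive_bounded_lipschitz (fun u => g x y u) (fun u => gt x y u)); auto.
    intros u; apply Rle_trans with (1 := Bt x y u); assumption.
Qed.

End RealLipschitz.

(** A point where [f] is nonzero lies in the support, and its coordinates are at most its Euclidean
    norm. The disk is thus used only through the enclosing square. *)
Lemma supported_in_disk_vanish (f : SE2fun) (a x y t : R) :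
  supported_in_disk f a -> a <= Rabs x \/ a <= Rabs y -> f x y t = RtoC 0.
Proof.
  intros Hs H. apply NNPP; intros Hn.
  assert (S : sqrt (x ^ 2 + y ^ 2) < a).
  { apply (Hs x y t). intros eps He. exists x, y, t.
    rewrite !Rminus_diag, Rabs_R0. auto. }
  assert (Rabs x <= sqrt (x ^ 2 + y ^ 2)).
  { rewrite <- sqrt_Rsqr_abs. apply sqrt_le_1_alt. unfold Rsqr; nra. }
  assert (Rabs y <= sqrt (x ^ 2 + y ^ 2)).
  { rewrite <- sqrt_Rsqr_abs. apply sqrt_le_1_alt. unfold Rsqr; nra. }
  lra.
Qed.

Lemma Cmod_le_components (z : C) : Cmod z <= Rabs (fst z) + Rabs (snd z).
Proof.
  replace z with (Cplus (RtoC (fst z)) (Cmult Ci (RtoC (snd z)))) at 1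
    by (destruct z; unfold Cplus, Cmult, Ci, RtoC; simpl; f_equal; ring).
  eapply Rle_trans; [apply Cmod_triangle|].
  rewrite Cmod_mult, Cmod_Ci, !Cmod_R. lra.
Qed.

Lemma C1_SE2_lipschitz (f : SE2fun) :
  C1_SE2 f -> supported_in_disk f (/ 4) -> exists M, 0 <= M /\
    (forall x y t, Cmod (f x y t) <= M) /\
    (forall y t, lipschitz M (fun x => f x y t)) /\
    (forall x t, lipschitz M (fun y => f x y t)) /\
    (forall x y, lipschitz M (fun t => f x y t)).
Proof.
  intros [H1 [H2 Hp]] Hs.
  destruct (C1_real_lipschitz (fun x y t => fst (f x y t))) as [M1 [P1 B1]]; auto.
  { intros; now rewrite Hp. }
  { intros; now rewrite (supported_in_disk_vanish f (/ 4)). }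
  destruct (C1_real_lipschitz (fun x y t => snd (f x y t))) as [M2 [P2 B2]]; auto.
  { intros; now rewrite Hp. }
  { intros; now rewrite (supported_in_disk_vanish f (/ 4)). }
  exists (M1 + M2). split; [lra|].
  repeat split; repeat intro;
    (eapply Rle_trans; [apply Cmod_le_components|]); rewrite ?Rmult_plus_distr_r;
    apply Rplus_le_compat; first [apply B1 | apply B2].
Qed.

(** * Discrete convolution *)

Lemma phi_conj_split (k1 k2 k3 : Z) (x y t : R) :
  phi_conj k1 k2 k3 x y t =
  Cmult (cis (- (2 * PI * (IZR k1 * x))))
    (Cmult (cis (- (2 * PI * (IZR k2 * y)))) (cis (- (IZR k3 * t)))).
Proof. unfold phi_conj. rewrite <- !cis_plus. f_equal; ring. Qed.

(** The mode is a character of the additive group; this is what factors the transform of a discrete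
    convolution. *)
Lemma phi_conj_minus (k1 k2 k3 : Z) (x y t x' y' t' : R) :
  phi_conj k1 k2 k3 x' y' t' =
  Cmult (phi_conj k1 k2 k3 x y t) (phi_conj k1 k2 k3 (x' - x) (y' - y) (t' - t)).
Proof. unfold phi_conj. rewrite <- cis_plus. f_equal; ring. Qed.

Lemma Cmod_phi_conj (k1 k2 k3 : Z) (x y t : R) : Cmod (phi_conj k1 k2 k3 x y t) = 1.
Proof. apply Cmod_cis. Qed.

Lemma cis_period_nat (a : R) (n : nat) : cis (a + 2 * INR n * PI) = cis a.
Proof. unfold cis. now rewrite cos_period, sin_period. Qed.

Lemma cis_period (a : R) (k : Z) : cis (a + 2 * PI * IZR k) = cis a.
Proof.
  destruct (Z_le_gt_dec 0 k) as [h|h].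
  - rewrite <- (cis_period_nat a (Z.to_nat k)), INR_IZR_INZ, Z2Nat.id by assumption.
    f_equal; ring.
  - rewrite <- (cis_period_nat (a + 2 * PI * IZR k) (Z.to_nat (- k))), INR_IZR_INZ, Z2Nat.id by lia.
    rewrite opp_IZR. f_equal; ring.
Qed.

Lemma dft_avg (g : SE2fun) (k1 k2 k3 : Z) (Lx Ly Lr : nat) :
  dft g k1 k2 k3 Lx Ly Lr =
  avg Lx (fun i => avg Ly (fun j => avg Lr (fun l =>
    let x := - / 2 + INR i / INR Lx in
    let y := - / 2 + INR j / INR Ly in
    let t := 2 * PI * INR l / INR Lr in
    Cmult (g x y t) (phi_conj k1 k2 k3 x y t)))).
Proof.
  unfold dft, avg.
  rewrite !Rinv_mult, !RtoC_mult, <- !Cmult_assoc. f_equal.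
  rewrite <- csum_scal, <- csum_scal. apply csum_ext; intros i _.
  f_equal. symmetry. apply csum_scal.
Qed.

Lemma SE2_conv_radial (f rho : SE2fun) (x' y' t' : R) :
  radial_in_translations rho ->
  SE2_conv f rho x' y' t' =
  SE2_integral (fun x y t => Cmult (f x y t) (rho (x' - x) (y' - y) (t' - t))).
Proof.
  intros Hr. unfold SE2_conv. f_equal.
  do 3 (apply functional_extensionality; intro). f_equal.
  (* The inverse rotation in the group law is the rotation by the opposite angle, which radiality
     removes. *)
  rewrite <- (Hr (x' - x) (y' - x0) (t' - x1) (- x1)), cos_neg, sin_neg.
  f_equal; ring.
Qed.

(** * Fourier averages over differences of grid points *)

Section Recentering.

Variables (M : R) (rho : SE2fun) (Kx Ky Kr : nat) (k1 k2 k3 : Z).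
Hypothesis rho_lip1 : forall y t, lipschitz M (fun x => rho x y t).
Hypothesis rho_lip2 : forall x t, lipschitz M (fun y => rho x y t).
Hypothesis rho_supp : forall x y t, / 4 <= Rabs x \/ / 4 <= Rabs y -> rho x y t = RtoC 0.
Hypothesis rho_per : forall x y t, rho x y (t + 2 * PI) = rho x y t.
Hypotheses (Kx_pos : (1 <= Kx)%nat) (Ky_pos : (1 <= Ky)%nat).
Hypothesis k1_le : (Z.abs k1 <= Z.of_nat Kx)%Z.
Hypothesis k2_le : (Z.abs k2 <= Z.of_nat Ky)%Z.

Let Lx := (2 * Kx + 1)%nat.
Let Ly := (2 * Ky + 1)%nat.
Let Lr := (2 * Kr + 1)%nat.
Let X i := - / 2 + INR i / INR Lx.
Let Y j := - / 2 + INR j / INR Ly.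
Let T l := 2 * PI * INR l / INR Lr.
Let H x y t := Cmult (rho x y t) (phi_conj k1 k2 k3 x y t).

Lemma dft_recentered (p q r : nat) :
  Rabs (X p) <= / 4 -> Rabs (Y q) <= / 4 ->
  Cmod (Cminus
    (avg Lx (fun i => avg Ly (fun j => avg Lr (fun l => H (X i - X p) (Y j - Y q) (T l - T r)))))
    (avg Lx (fun i => avg Ly (fun j => avg Lr (fun l => H (X i) (Y j) (T l))))))
  <= M / INR Ly + M / INR Lx.
Proof.
  intros Hp Hq.
  assert (Lx0 : (0 < Lx)%nat) by (unfold Lx; lia).
  assert (Ly0 : (0 < Ly)%nat) by (unfold Ly; lia).
  assert (Lr0 : (0 < Lr)%nat) by (unfold Lr; lia).
  (* The angle is recentered exactly by periodicity; [y] and then [x] follow at the cost of one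
     half-step estimate each. *)
  rewrite (avg_ext Lx _ (fun i => avg Ly (fun j => avg Lr (fun l => H (X i - X p) (Y j - Y q) (T l))))).
  2:{ intros i _; apply avg_ext; intros j _. unfold T.
      apply (periodic_grid_difference_avg (fun t => H (X i - X p) (Y j - Y q) t)); [assumption|].
      intros t; unfold H. rewrite rho_per. f_equal. unfold phi_conj.
      rewrite <- (cis_period _ k3). f_equal; ring. }
  apply Cmod_minus_trans with
    (avg Lx (fun i => avg Ly (fun j => avg Lr (fun l => H (X i - X p) (Y j) (T l))))).
  - apply avg_dist_le; [assumption|]; intros i _.
    rewrite avg_swap, (avg_swap Ly). apply avg_dist_le; [assumption|]; intros l _.
    set (G := fun y => Cmult (rho (X i - X p) y (T l))
      (cis (- (2 * PI * (IZR k1 * (X i - X p))) + - (IZR k3 * T l)))).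
    assert (E : forall y, H (X i - X p) y (T l) = Cmult (G y) (cis (- (2 * PI * (IZR k2 * y))))).
    { intros y; unfold H, G. rewrite phi_conj_split, cis_plus. ring. }
    rewrite (avg_ext Ly _ _ (fun j _ => E (Y j - Y q))), (avg_ext Ly _ _ (fun j _ => E (Y j))).
    apply (grid_difference_avg M G Ky k2); try assumption.
    + apply (lipschitz_mult_cis M _ (fun y => rho (X i - X p) y (T l))), rho_lip2.
    + intros y Hy; unfold G. rewrite rho_supp by auto. ring.
  - rewrite avg_swap, (avg_swap Lx). apply avg_dist_le; [assumption|]; intros j _.
    rewrite avg_swap, (avg_swap Lx). apply avg_dist_le; [assumption|]; intros l _.
    set (G := fun x => Cmult (rho x (Y j) (T l))
      (cis (- (2 * PI * (IZR k2 * Y j)) + - (IZR k3 * T l)))).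
    assert (E : forall x, H x (Y j) (T l) = Cmult (G x) (cis (- (2 * PI * (IZR k1 * x))))).
    { intros x; unfold H, G. rewrite phi_conj_split, cis_plus. ring. }
    rewrite (avg_ext Lx _ _ (fun i _ => E (X i - X p))), (avg_ext Lx _ _ (fun i _ => E (X i))).
    apply (grid_difference_avg M G Kx k1); try assumption.
    + apply (lipschitz_mult_cis M _ (fun x => rho x (Y j) (T l))), rho_lip1.
    + intros x Hx; unfold G. rewrite rho_supp by auto. ring.
Qed.

End Recentering.

Lemma avg3_swap (l m n l' m' n' : nat) (F : nat -> nat -> nat -> nat -> nat -> nat -> C) :
  avg l (fun i => avg m (fun j => avg n (fun k =>
    avg l' (fun i' => avg m' (fun j' => avg n' (fun k' => F i j k i' j' k')))))) =
  avg l' (fun i' => avg m' (fun j' => avg n' (fun k' =>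
    avg l (fun i => avg m (fun j => avg n (fun k => F i j k i' j' k')))))).
Proof.
  (* A single average is moved outwards through three others; this is done for each of the three
     inner ones. *)
  assert (one : forall (p : nat) (G : nat -> nat -> nat -> nat -> C),
    avg l (fun i => avg m (fun j => avg n (fun k => avg p (fun q => G i j k q)))) =
    avg p (fun q => avg l (fun i => avg m (fun j => avg n (fun k => G i j k q))))).
  { intros p G. rewrite (avg_swap p l). apply avg_ext; intros i _.
    rewrite (avg_swap p m). apply avg_ext; intros j _. apply avg_swap. }
  rewrite one. apply avg_ext; intros i' _.
  rewrite one. apply avg_ext; intros j' _. apply one.
Qed.

Theorem mainTheorem7 (f rho : SE2fun) :
  C1_SE2 f -> C1_SE2 rho ->
  supported_in_disk f (/ 4) -> supported_in_disk rho (/ 4) ->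
  radial_in_translations rho ->
  exists Cst : R, 0 < Cst /\
    forall (Kx Ky Kr : nat) (k1 k2 k3 : Z),
      (1 <= Kx)%nat -> (1 <= Ky)%nat -> (1 <= Kr)%nat ->
      (Z.abs k1 <= Z.of_nat Kx)%Z -> (Z.abs k2 <= Z.of_nat Ky)%Z ->
      (Z.abs k3 <= Z.of_nat Kr)%Z ->
      let Lx := (2 * Kx + 1)%nat in
      let Ly := (2 * Ky + 1)%nat in
      let Lr := (2 * Kr + 1)%nat in
      Cmod (Cminus (dft (SE2_conv f rho) k1 k2 k3 Lx Ly Lr)
                   (Cmult (dft f k1 k2 k3 Lx Ly Lr) (dft rho k1 k2 k3 Lx Ly Lr)))
        <= Cst / INR (Nat.min Kx (Nat.min Ky Kr)).
Proof.
  intros Cf Cr Sf Sr Rad. assert (P := PI_RGT_0).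
  destruct (C1_SE2_lipschitz f Cf Sf) as [A [A0 [Af [Af1 [Af2 Af3]]]]].
  destruct (C1_SE2_lipschitz rho Cr Sr) as [B [B0 [Br [Br1 [Br2 Br3]]]]].
  assert (AB : 0 <= A * B) by now apply Rmult_le_pos.
  (* [A] and [B] bound size and slopes of [f] and [rho], so [N] is a Lipschitz constant of the
     convolution integrand. *)
  set (N := 2 * A * B).
  (* The terms with [N] come from the Riemann sums in x, y and the angle, [A * (B + B)] from the
     recentering; the 1 ensures positivity. *)
  exists (N + N + 2 * PI * N + A * (B + B) + 1).
  assert (N0 : 0 <= N) by (unfold N; lra).
  assert (PN : 0 <= 2 * PI * N) by (apply Rmult_le_pos; lra).
  split; [lra|].
  intros Kx Ky Kr k1 k2 k3 HKx HKy HKr Hk1 Hk2 Hk3 Lx Ly Lr.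
  assert (Lx0 : (0 < Lx)%nat) by (unfold Lx; lia).
  assert (Ly0 : (0 < Ly)%nat) by (unfold Ly; lia).
  assert (Lr0 : (0 < Lr)%nat) by (unfold Lr; lia).
  set (m := Nat.min Kx (Nat.min Ky Kr)).
  assert (m0 : 0 < INR m) by (apply (lt_INR 0); unfold m; lia).
  assert (div_le : forall c L, 0 <= c -> (m <= L)%nat -> c / INR L <= c / INR m).
  { intros c L Hc HL. apply Rmult_le_compat_l; [assumption|].
    apply Rinv_le_contravar; [assumption | now apply le_INR]. }
  rewrite !dft_avg. cbv zeta.
  set (X := fun i => - / 2 + INR i / INR Lx).
  set (Y := fun j => - / 2 + INR j / INR Ly).
  set (T := fun l => 2 * PI * INR l / INR Lr).
  set (ph := phi_conj k1 k2 k3).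
  set (rhat := avg Lx (fun i => avg Ly (fun j => avg Lr (fun l =>
    Cmult (rho (X i) (Y j) (T l)) (ph (X i) (Y j) (T l)))))).
  change (Cmod (Cminus
    (avg Lx (fun i => avg Ly (fun j => avg Lr (fun l =>
       Cmult (SE2_conv f rho (X i) (Y j) (T l)) (ph (X i) (Y j) (T l))))))
    (Cmult (avg Lx (fun i => avg Ly (fun j => avg Lr (fun l =>
       Cmult (f (X i) (Y j) (T l)) (ph (X i) (Y j) (T l)))))) rhat)) <=
    (N + N + 2 * PI * N + A * (B + B) + 1) / INR m).
  apply Rle_trans with ((N / INR Lx + N / INR Ly + 2 * PI * N / INR Lr)
    + A * (B / INR Ly + B / INR Lx)).
  2:{ assert (h1 := div_le N Lx N0 ltac:(unfold m, Lx; lia)).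
      assert (h2 := div_le N Ly N0 ltac:(unfold m, Ly; lia)).
      assert (h3 := div_le (2 * PI * N) Lr PN ltac:(unfold m, Lr; lia)).
      assert (h4 := div_le B Ly B0 ltac:(unfold m, Ly; lia)).
      assert (h5 := div_le B Lx B0 ltac:(unfold m, Lx; lia)).
      assert (h6 : A * (B / INR Ly + B / INR Lx) <= A * ((B + B) / INR m)).
      { apply Rmult_le_compat_l; [assumption|]. unfold Rdiv in *; lra. }
      assert (0 < / INR m) by now apply Rinv_0_lt_compat.
      unfold Rdiv in *. rewrite !Rmult_plus_distr_r. lra. }
  (* The intermediate quantity is the transform of the discrete convolution, with the mode split
     between [f] at a grid point and [rho] at the difference. *)
  apply Cmod_minus_trans with
    (avg Lx (fun p => avg Ly (fun q => avg Lr (fun r =>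
      Cmult (Cmult (f (X p) (Y q) (T r)) (ph (X p) (Y q) (T r)))
       (avg Lx (fun i => avg Ly (fun j => avg Lr (fun l =>
         Cmult (rho (X i - X p) (Y j - Y q) (T l - T r))
           (ph (X i - X p) (Y j - Y q) (T l - T r)))))))))).
  - match goal with |- Cmod (Cminus _ ?u) <= _ => replace u with
      (avg Lx (fun i => avg Ly (fun j => avg Lr (fun l => Cmult
        (avg Lx (fun p => avg Ly (fun q => avg Lr (fun r =>
          Cmult (f (X p) (Y q) (T r)) (rho (X i - X p) (Y j - Y q) (T l - T r))))))
        (ph (X i) (Y j) (T l)))))) end.
    + apply avg_dist_le; [assumption|]; intros i _.
      apply avg_dist_le; [assumption|]; intros j _.
      apply avg_dist_le; [assumption|]; intros l _.
      match goal with |- Cmod (Cminus (Cmult ?a ?c) (Cmult ?b ?c)) <= _ =>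
        replace (Cminus (Cmult a c) (Cmult b c)) with (Cmult (Cminus a b) c) by ring end.
      rewrite Cmod_mult. unfold ph at 1. rewrite Cmod_phi_conj, Rmult_1_r.
      rewrite SE2_conv_radial by assumption.
      apply (SE2_integral_riemann_sum_error N (fun x y t => Cmult (f x y t)
        (rho (X i - x) (Y j - y) (T l - t)))); try assumption.
      * intros y t. apply (lipschitz_mult A B (fun x => f x y t)
          (fun x => rho (X i - x) (Y j - y) (T l - t))); auto.
        apply (lipschitz_comp_minus B (X i) (fun x => rho x (Y j - y) (T l - t))), Br1.
      * intros x t. apply (lipschitz_mult A B (fun y => f x y t)
          (fun y => rho (X i - x) (Y j - y) (T l - t))); auto.
        apply (lipschitz_comp_minus B (Y j) (fun y => rho (X i - x) y (T l - t))), Br2.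
      * intros x y. apply (lipschitz_mult A B (fun t => f x y t)
          (fun t => rho (X i - x) (Y j - y) (T l - t))); auto.
        apply (lipschitz_comp_minus B (T l) (fun t => rho (X i - x) (Y j - y) t)), Br3.
      * intros x y t Hxy. rewrite (supported_in_disk_vanish f (/ 4)) by assumption. ring.
    (* The mode goes inside the sums, the two triple averages are exchanged, and the character
       property splits the mode. *)
    + transitivity (avg Lx (fun i => avg Ly (fun j => avg Lr (fun l =>
        avg Lx (fun p => avg Ly (fun q => avg Lr (fun r =>
          Cmult (ph (X i) (Y j) (T l)) (Cmult (f (X p) (Y q) (T r))
           (rho (X i - X p) (Y j - Y q) (T l - T r)))))))))).
      { do 3 (apply avg_ext; intros ? _). rewrite Cmult_comm, <- avg_scal.
        apply avg_ext; intros ? _. rewrite <- avg_scal.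
        apply avg_ext; intros ? _. symmetry; apply avg_scal. }
      rewrite avg3_swap. apply avg_ext; intros p _; apply avg_ext; intros q _; apply avg_ext; intros r _.
      rewrite <- avg_scal. apply avg_ext; intros i _.
      rewrite <- avg_scal. apply avg_ext; intros j _.
      rewrite <- avg_scal. apply avg_ext; intros l _.
      unfold ph at 1. rewrite (phi_conj_minus k1 k2 k3 (X p) (Y q) (T r)). fold ph. ring.
  - rewrite (Cmult_comm _ rhat), <- avg_scal. apply avg_dist_le; [assumption|]; intros p _.
    rewrite <- avg_scal. apply avg_dist_le; [assumption|]; intros q _.
    rewrite <- avg_scal. apply avg_dist_le; [assumption|]; intros r _.
    match goal with |- Cmod (Cminus (Cmult ?c ?a) (Cmult ?b ?c)) <= _ =>
      replace (Cminus (Cmult c a) (Cmult b c)) with (Cmult c (Cminus a b)) by ring end.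
    rewrite !Cmod_mult. unfold ph at 1. rewrite Cmod_phi_conj, Rmult_1_r.
    assert (E0 : 0 <= A * (B / INR Ly + B / INR Lx)).
    { apply Rmult_le_pos; [assumption|]. apply Rplus_le_le_0_compat;
        (apply Rdiv_le_0_compat; [assumption | now apply (lt_INR 0)]). }
    (* Outside the square the factor [f] vanishes; inside it the window of differences covers the
       support of [rho], as recentering requires. *)
    destruct (classic (/ 4 <= Rabs (X p) \/ / 4 <= Rabs (Y q))) as [h|h].
    + rewrite (supported_in_disk_vanish f (/ 4)) by assumption. rewrite Cmod_0; lra.
    + apply not_or_and in h. destruct h as [hx hy]. apply Rnot_le_lt in hx, hy.
      apply Rmult_le_compat; auto using Cmod_ge_0.
      apply (dft_recentered B rho Kx Ky Kr k1 k2 k3); try assumption.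
      * intros; now apply (supported_in_disk_vanish rho (/ 4)).
      * apply Cr.
      * left; exact hx.
      * left; exact hy.
Qed.
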